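(* Let $\mathbb{K}=\mathbb{R}$ or $\mathbb{C}$, let $n\ge 1$, and let $\mathfrak{g}=\mathfrak{h}\ltimes\mathbb{K}^n$ be the $2n$-dimensional Lie algebra over $\mathbb{K}$ with basis $e_1,\dots,e_{2n}$, where $\mathbb{K}^n=\mathrm{span}(e_1,\dots,e_n)$ and $\mathfrak{h}=\mathrm{span}(e_{n+1},\dots,e_{2n})$, whose only nonzero brackets (up to skew-symmetry) are $$[e_{n+i},e_i]=e_i,\qquad 1\le i\le n.$$ Then any symplectic form on $\mathfrak{g}$ is symplectomorphic to a form $$\omega_0=\sum_{i=1}^n e^i\wedge e^{n+i}+Z,$$ where $Z\in\wedge^2\mathfrak{h}^*$ is an arbitrary $2$-form on $\mathfrak{h}$. Moreover, $\omega_0$ is an exact $2$-form if and only if $Z=0$.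
   Context: $(e^i)_{1\le i\le 2n}$ denotes the basis of $\mathfrak{g}^*$ dual to $(e_i)$, and $\mathfrak{h}^*$ is identified with $\mathrm{span}(e^{n+1},\dots,e^{2n})\subset\mathfrak{g}^*$, so $\wedge^2\mathfrak{h}^*\subset\wedge^2\mathfrak{g}^*$. A symplectic form on a Lie algebra $\mathfrak{g}$ is a non-degenerate skew-symmetric bilinear form $\omega$ with $\omega([x,y],z)+\omega([y,z],x)+\omega([z,x],y)=0$ for all $x,y,z\in\mathfrak{g}$. A $2$-form is exact if it equals $(x,y)\mapsto\alpha([x,y])$ for some $\alpha\in\mathfrak{g}^*$. Two symplectic forms $\omega,\omega'$ on $\mathfrak{g}$ are symplectomorphic if there is a Lie algebra automorphism $T$ of $\mathfrak{g}$ with $T^*\omega=\omega'$, where $(T^*\omega)(x,y)=\omega(Tx,Ty)$. *)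

(* Defs.v *)
From HB Require Import structures.
From mathcomp Require Import all_boot all_algebra ring.
From mathcomp Require Export sesquilinear.
From mathcomp Require Export reals.
From mathcomp Require Export complex.

Set Implicit Arguments.
Unset Strict Implicit.
Unset Printing Implicit Defensive.

Import GRing.Theory.
Local Open Scope ring_scope.

HB.mixin Record isLieAlgebra (K : fieldType) (g : Type) of GRing.Lmodule K g := {
  lie : g -> g -> g;
  lie_linearl : forall y : g, linear (lie ^~ y);
  lie_linearr : forall x : g, linear (lie x);
  liexx : forall x : g, lie x x = 0;
  lie_jacobi : forall x y z : g,
    lie x (lie y z) + lie y (lie z x) + lie z (lie x y) = 0
}.

#[short(type="lieAlgType")]
HB.structure Definition LieAlgebra (K : fieldType) :=
  { g of Vector K g & isLieAlgebra K g }.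

Notation "[| x , y |]" := (lie x y)
  (at level 0, x at level 99, format "[| x ,  y |]") : ring_scope.

Section LieBilinear.
Variables (K : fieldType) (g : lieAlgType K).

Fact lie_is_bilinear : bilinear_for
  (GRing.Scale.Law.clone _ _ *:%R _) (GRing.Scale.Law.clone _ _ *:%R _)
  (@lie K g).
Proof. by split=> [y|x] a u v; [apply: lie_linearl | apply: lie_linearr]. Qed.

HB.instance Definition _ :=
  bilinear_isBilinear.Build K g g g _ _ (@lie K g) lie_is_bilinear.

End LieBilinear.

Definition lie_automorphism (K : fieldType) (g : lieAlgType K)
    (T : {linear g -> g}) : Prop :=
  bijective T /\ {morph T : x y / [| x, y |]}.

(* {skew_symmetric g} serves as the type of 2-forms on g: this is intended for *)
(* K of characteristic other than 2, where skew-symmetric means alternating.  *)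
Definition symplectic (K : fieldType) (g : lieAlgType K)
    (omega : {skew_symmetric g}) : Prop :=
  nondegenerate omega /\
  forall x y z : g,
    omega [| x, y |] z + omega [| y, z |] x + omega [| z, x |] y = 0.

Definition exact_form (K : fieldType) (g : lieAlgType K)
    (omega : {skew_symmetric g}) : Prop :=
  exists alpha : {scalar g}, forall x y : g, omega x y = alpha [| x, y |].

Definition symplectomorphic (K : fieldType) (g : lieAlgType K)
    (omega omega' : {skew_symmetric g}) : Prop :=
  exists2 T : {linear g -> g}, lie_automorphism T &
    forall x y : g, omega (T x) (T y) = omega' x y.

(* No factor 1/2 in the exterior product of two linear forms. *)
Definition wedge (K : fieldType) (V : lmodType K) (a b : {scalar V})
    (x y : V) : K :=
  a x * b y - a y * b x.

Section Forms.
Variables (K : fieldType) (n : nat) (g : lieAlgType K) (e : (n + n).-tuple g).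

(* With 0-based i, evec i is e_(i+1) and hvec i is e_(n+i+1); ecoord i and     *)
(* hcoord i are the corresponding members of the dual basis.                   *)
Definition evec (i : 'I_n) : g := tnth e (lshift n i).
Definition hvec (i : 'I_n) : g := tnth e (rshift n i).
Definition ecoord (i : 'I_n) : {scalar g} := coord e (lshift n i).
Definition hcoord (i : 'I_n) : {scalar g} := coord e (rshift n i).

Definition structure_brackets : Prop :=
  [/\ forall i j, [| hvec i, evec j |] = if i == j then evec i else 0,
      forall i j, [| evec i, evec j |] = 0
    & forall i j, [| hvec i, hvec j |] = 0].

Definition in_wedge2_h (Z : {skew_symmetric g}) : Prop :=
  exists c : 'M[K]_n, forall x y : g,
    Z x y = \sum_(i < n) \sum_(j < n | (i < j)%N)
              c i j * wedge (hcoord i) (hcoord j) x y.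

Definition omega0 (Z : {skew_symmetric g}) (x y : g) : K :=
  \sum_(i < n) wedge (ecoord i) (hcoord i) x y + Z x y.

Variable Z : {skew_symmetric g}.

Fact omega0_is_bilinear : bilinear_for
  (GRing.Scale.Law.clone _ _ *%R _) (GRing.Scale.Law.clone _ _ (idfun \; *%R) _)
  (omega0 Z).
Proof.
split=> [y|x] a u v /=; rewrite /omega0 /=.
  rewrite linearPl mulrDr addrACA mulr_sumr -big_split /=; congr (_ + _).
  apply: eq_bigr => i _; rewrite /wedge !linearP /=.
  by ring.
rewrite linearPr mulrDr addrACA mulr_sumr -big_split /=; congr (_ + _).
apply: eq_bigr => i _; rewrite /wedge !linearP /=.
by ring.
Qed.

HB.instance Definition _ := bilinear_isBilinear.Build K g g K
  (GRing.Scale.Law.clone _ _ *%R _) (GRing.Scale.Law.clone _ _ (idfun \; *%R) _)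
  (omega0 Z) omega0_is_bilinear.

Fact omega0_skew (x y : g) :
  omega0 Z x y = (-1) ^+ true * idfun (omega0 Z y x).
Proof.
rewrite /omega0 /= expr1 mulN1r opprD -sumrN; congr (_ + _).
  by apply: eq_bigr => i _; rewrite /wedge opprB.
by rewrite hermC /= expr1 mulN1r.
Qed.

HB.instance Definition _ := isHermitianSesquilinear.Build K g true idfun
  (omega0 Z) omega0_skew.

End Forms.

(* Main.v *)
(* The cocycle condition on (e_i, e_j, e_(n+i)) gives omega(e_i, e_j) = 0, and *)
(* on (e_i, e_(n+i), e_(n+j)) with i != j it gives omega(e_i, e_(n+j)) = 0.    *)
(* Hence omega = sum_i a_i e^i /\ e^(n+i) + Z with Z a 2-form on h; the a_i    *)
(* are nonzero by nondegeneracy, and e_i |-> e_i / a_i normalizes them to 1.   *)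
(* An exact form vanishes on the abelian h, which forces Z = 0; for Z = 0 the  *)
(* primitive alpha is - sum_i e^i.                                             *)

Require Import Defs.
From HB Require Import structures.
From mathcomp Require Import all_boot all_algebra ring.

Set Implicit Arguments.
Unset Strict Implicit.
Unset Printing Implicit Defensive.

Import GRing.Theory.
Local Open Scope ring_scope.

(** By [lie_coord], every bracket lies in the span of the [evec i], and [[x, y]] has i-th coordinate
    [wedge (hcoord e i) (ecoord e i) x y], so identities about brackets become polynomial identities
    in coordinates. The cocycle condition makes span([evec i]) isotropic and pairs [evec i] with no
    [hvec j] other than [hvec i], whence the expansion [symplectic_coord]. Nondegeneracy makes the
    remaining pairings invertible, and a diagonal automorphism fixing every [hvec i] turns them into
    1 without changing the part on h. Conversely [omega0_symplectic] shows that every Z on h is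
    allowed, and [omega0_exact] settles exactness by testing on the abelian h. *)

(** * Skew-symmetric forms and wedges of linear forms *)

Lemma wedgeC (K : fieldType) (V : lmodType K) (a b : {scalar V}) (x y : V) :
  wedge a b y x = - wedge a b x y.
Proof. by rewrite /wedge; ring. Qed.

Lemma wedge_linearl (K : fieldType) (V : lmodType K) (a b : {scalar V}) (y : V) :
  scalar (wedge a b ^~ y).
Proof. by move=> k u v; rewrite /wedge !linearP /=; ring. Qed.

Lemma wedge_linearr (K : fieldType) (V : lmodType K) (a b : {scalar V}) (x : V) :
  scalar (wedge a b x).
Proof. by move=> k u v; rewrite /wedge !linearP /=; ring. Qed.

Lemma skewC (K : fieldType) (V : lmodType K) (f : {skew_symmetric V}) (x y : V) :
  f y x = - f x y.
Proof. by rewrite hermC /= expr1 mulN1r. Qed.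

Lemma skew_xx (K : fieldType) (V : lmodType K) (f : {skew_symmetric V}) (x : V) :
  2%:R != 0 :> K -> f x x = 0.
Proof.
move=> two_neq0; apply/eqP; move: (skewC f x x) => /eqP.
by rewrite -addr_eq0 -mulr2n -mulr_natl mulf_eq0 (negPf two_neq0).
Qed.

Lemma nondegenerateP (K : fieldType) (V : vectType K) (f : {skew_symmetric V}) :
  nondegenerate f <-> forall x, (forall y, f x y = 0) -> x = 0.
Proof.
rewrite /nondegenerate; split=> [/eqP rad0 x fx0 | f_inj].
  apply/eqP; rewrite -memv0 -rad0.
  by apply/mem_orthovP => y _; apply: fx0.
rewrite -subv0; apply/subvP => x /mem_orthovP fx0.
by rewrite memv0; apply/eqP/f_inj => y; apply: fx0; apply: memvf.
Qed.

(** The diagonal drops out, and exchanging the indices folds the terms with j < i onto those with i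
    < j. This brings a form given by its values on a basis to the shape required by
    [in_wedge2_h]. *)
Lemma sum_skew_pairs (K : fieldType) (n : nat) (c : 'I_n -> 'I_n -> K)
    (u v : 'I_n -> K) :
  (forall i, c i i = 0) -> (forall i j, c j i = - c i j) ->
  \sum_i \sum_j u i * v j * c i j =
  \sum_(i < n) \sum_(j < n | (i < j)%N) c i j * (u i * v j - u j * v i).
Proof.
move=> c_diag c_skew.
have -> : \sum_i \sum_j u i * v j * c i j =
    \sum_(i < n) \sum_(j < n | (i < j)%N) u i * v j * c i j +
    \sum_(i < n) \sum_(j < n | (j < i)%N) u i * v j * c i j.
  rewrite -big_split /=; apply: eq_bigr => i _.
  rewrite (bigID (fun j : 'I_n => (i < j)%N)) /=; congr (_ + _).
  rewrite (bigID (fun j : 'I_n => (j < i)%N)) /= [X in _ + X]big1 ?addr0.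
    by apply: eq_bigl => j; case: ltngtP.
  move=> j; rewrite -!leqNgt => /andP[le_ji le_ij].
  suff -> : i = j by rewrite c_diag mulr0.
  by apply/val_inj/eqP; rewrite eqn_leq le_ij.
rewrite [X in _ + X](exchange_big_dep xpredT) //= -big_split /=; apply: eq_bigr => i _.
rewrite -big_split /=; apply: eq_bigr => j _.
by rewrite (c_skew i j); ring.
Qed.

Section TwoFormsOnH.
Variables (K : fieldType) (n : nat) (g : lieAlgType K) (e : (n + n).-tuple g).

(** The body repeats the formula of [in_wedge2_h], so once it is packaged as a skew form it belongs
    to that space with [c] as witness. *)
Definition wedge2_h (c : 'M[K]_n) (x y : g) : K :=
  \sum_(i < n) \sum_(j < n | (i < j)%N)
    c i j * wedge (hcoord e i) (hcoord e j) x y.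

Variable c : 'M[K]_n.

Fact wedge2_h_is_bilinear : bilinear_for
  (GRing.Scale.Law.clone _ _ *%R _) (GRing.Scale.Law.clone _ _ (idfun \; *%R) _)
  (wedge2_h c).
Proof.
split=> [y|x] a u v /=; rewrite /wedge2_h mulr_sumr -big_split /=;
  apply: eq_bigr => i _; rewrite mulr_sumr -big_split /=;
  apply: eq_bigr => j _; rewrite ?wedge_linearl ?wedge_linearr /=; ring.
Qed.

HB.instance Definition _ := bilinear_isBilinear.Build K g g K
  (GRing.Scale.Law.clone _ _ *%R _) (GRing.Scale.Law.clone _ _ (idfun \; *%R) _)
  (wedge2_h c) wedge2_h_is_bilinear.

Fact wedge2_h_skew (x y : g) :
  wedge2_h c x y = (-1) ^+ true * idfun (wedge2_h c y x).
Proof.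
rewrite /= expr1 mulN1r -sumrN; apply: eq_bigr => i _; rewrite -sumrN.
by apply: eq_bigr => j _; rewrite [in RHS]wedgeC mulrN opprK.
Qed.

HB.instance Definition _ := isHermitianSesquilinear.Build K g true idfun
  (wedge2_h c) wedge2_h_skew.

End TwoFormsOnH.

(** * Coordinates and the bracket in the basis [e] *)

Section Coordinates.
Variables (K : fieldType) (n : nat) (g : lieAlgType K) (e : (n + n).-tuple g).
Hypothesis he : basis_of fullv e.

Local Notation x_ := (evec e).
Local Notation h_ := (hvec e).

Let coordE i j : coord e i (tnth e j) = (i == j)%:R.
Proof. by rewrite (tnth_nth 0) coord_free ?(basis_free he) // eq_sym. Qed.

Lemma ecoord_evec i j : ecoord e i (x_ j) = (i == j)%:R.
Proof. by rewrite /ecoord /evec /= coordE (inj_eq (@lshift_inj _ _)). Qed.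

Lemma ecoord_hvec i j : ecoord e i (h_ j) = 0.
Proof. by rewrite /ecoord /hvec /= coordE eq_lrshift. Qed.

Lemma hcoord_evec i j : hcoord e i (x_ j) = 0.
Proof. by rewrite /hcoord /evec /= coordE eq_rlshift. Qed.

Lemma hcoord_hvec i j : hcoord e i (h_ j) = (i == j)%:R.
Proof. by rewrite /hcoord /hvec /= coordE (inj_eq (@rshift_inj _ _)). Qed.

Lemma coord_decomp (x : g) :
  x = \sum_i ecoord e i x *: x_ i + \sum_i hcoord e i x *: h_ i.
Proof.
rewrite {1}(coord_basis he (memvf x)) big_split_ord /=.
by congr (_ + _); apply: eq_bigr => i _; rewrite ?/evec ?/hvec (tnth_nth 0).
Qed.

Lemma coord_eq (x y : g) :
  (forall i, ecoord e i x = ecoord e i y) ->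
  (forall i, hcoord e i x = hcoord e i y) -> x = y.
Proof.
move=> eqx eqh; rewrite [x]coord_decomp [y]coord_decomp.
by congr (_ + _); apply: eq_bigr => i _; rewrite ?eqx ?eqh.
Qed.

Lemma ecoord_sum i (u v : 'I_n -> K) :
  ecoord e i (\sum_j u j *: x_ j + \sum_j v j *: h_ j) = u i.
Proof.
rewrite raddfD !raddf_sum /= [X in _ + X]big1 => [ |j _]; last first.
  by rewrite linearZ /= ecoord_hvec mulr0.
rewrite addr0 (bigD1 i) //= big1 => [ |j ji]; rewrite linearZ /= ecoord_evec.
  by rewrite eqxx mulr1 addr0.
by rewrite eq_sym (negPf ji) mulr0.
Qed.

Lemma hcoord_sum i (u v : 'I_n -> K) :
  hcoord e i (\sum_j u j *: x_ j + \sum_j v j *: h_ j) = v i.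
Proof.
rewrite raddfD !raddf_sum /= [X in X + _]big1 => [ |j _]; last first.
  by rewrite linearZ /= hcoord_evec mulr0.
rewrite add0r (bigD1 i) //= big1 => [ |j ji]; rewrite linearZ /= hcoord_hvec.
  by rewrite eqxx mulr1 addr0.
by rewrite eq_sym (negPf ji) mulr0.
Qed.

Hypothesis hbr : structure_brackets e.

Lemma lieC (x y : g) : [| y, x |] = - [| x, y |].
Proof.
apply/eqP; rewrite -addr_eq0.
have := liexx (x + y); rewrite linearDl !linearDr /= !liexx add0r addr0.
by rewrite addrC => ->.
Qed.

(** Of the four blocks of the expanded bracket, the two inside the abelian spans vanish, and the
    mixed ones differ by a swap and a sign. These are the structure equations: up to sign, each
    [ecoord e i] has differential [wedge (hcoord e i) (ecoord e i)], and each [hcoord e i] is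
    closed. *)
Lemma lie_coord (x y : g) :
  [| x, y |] = \sum_i wedge (hcoord e i) (ecoord e i) x y *: x_ i.
Proof.
have [he_br ee_br hh_br] := hbr.
have lie_sum (u v : 'I_n -> K) (a b : 'I_n -> g) :
    [| \sum_i u i *: a i, \sum_j v j *: b j |] =
    \sum_i \sum_j (u i * v j) *: [| a i, b j |].
  rewrite linear_sumlz; apply: eq_bigr => i _.
  rewrite linear_sumr; apply: eq_bigr => j _.
  by rewrite linearZl_LR linearZr_LR /= scalerA.
have lie_he (u v : 'I_n -> K) :
    [| \sum_i u i *: h_ i, \sum_j v j *: x_ j |] = \sum_i (u i * v i) *: x_ i.
  rewrite lie_sum; apply: eq_bigr => i _.
  rewrite (bigD1 i) //= he_br eqxx big1 ?addr0 // => j ji.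
  by rewrite he_br eq_sym (negPf ji) scaler0.
rewrite {1}[x]coord_decomp {1}[y]coord_decomp linearDl !linearDr /= lie_he.
rewrite [X in X + _ + _]lie_sum [X in X + _ + _]big1 => [ |i _]; last first.
  by rewrite big1 // => j _; rewrite ee_br scaler0.
rewrite [X in _ + (_ + X)]lie_sum [X in _ + (_ + X)]big1 => [ |i _]; last first.
  by rewrite big1 // => j _; rewrite hh_br scaler0.
rewrite lieC lie_he add0r addr0 -sumrN -big_split; apply: eq_bigr => i _ /=.
by rewrite -scaleNr -scalerDl; congr (_ *: _); rewrite /wedge; ring.
Qed.

Lemma ecoord_lie i (x y : g) :
  ecoord e i [| x, y |] = wedge (hcoord e i) (ecoord e i) x y.
Proof.
have := ecoord_sum i (fun k => wedge (hcoord e k) (ecoord e k) x y) (fun=> 0).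
by rewrite [X in _ + X]big1 ?addr0 -?lie_coord // => j _; rewrite scale0r.
Qed.

Lemma hcoord_lie i (x y : g) : hcoord e i [| x, y |] = 0.
Proof.
have := hcoord_sum i (fun k => wedge (hcoord e k) (ecoord e k) x y) (fun=> 0).
by rewrite [X in _ + X]big1 ?addr0 -?lie_coord // => j _; rewrite scale0r.
Qed.

(** * The model forms: symplecticity and exactness *)

Section InWedge2H.
Variable Z : {skew_symmetric g}.
Hypothesis Zh : in_wedge2_h e Z.

Lemma in_wedge2_h_eq0 (x y : g) : (forall i, hcoord e i x = 0) -> Z x y = 0.
Proof.
have [c ->] := Zh => x0; apply: big1 => i _; apply: big1 => j _.
by rewrite /wedge !x0 mul0r mulr0 subrr mulr0.
Qed.

Lemma omega0_evecr i (x : g) : omega0 e Z x (x_ i) = - hcoord e i x.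
Proof.
rewrite /omega0 [Z _ _]skewC in_wedge2_h_eq0 ?oppr0 ?addr0 => [ |k]; last first.
  exact: hcoord_evec.
rewrite (bigD1 i) // big1 => [ |j ji]; rewrite /wedge ecoord_evec hcoord_evec.
  by rewrite eqxx mulr0 mul1r sub0r /= addr0.
by rewrite (negPf ji) mulr0 mul0r subr0.
Qed.

Lemma omega0_hvecr i (x : g) : (forall k, hcoord e k x = 0) ->
  omega0 e Z x (h_ i) = ecoord e i x.
Proof.
move=> x0; rewrite /omega0 in_wedge2_h_eq0 // addr0 (bigD1 i) // big1 => [ |j ji];
  rewrite /wedge ecoord_hvec hcoord_hvec.
  by rewrite eqxx mulr1 mul0r subr0 /= addr0.
by rewrite (negPf ji) mulr0 mul0r subr0.
Qed.

(** Pairing a radical vector with [evec i] reads off its h-coordinates; once these vanish, Z no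
    longer contributes and pairing with [hvec i] reads off the others. In the cocycle sum Z
    disappears because brackets have no h-coordinates. *)
Lemma omega0_symplectic : symplectic (omega0 e Z).
Proof.
split=> [ |x y z].
  apply/nondegenerateP => x wx0.
  have x0 i : hcoord e i x = 0.
    by apply/eqP; rewrite -oppr_eq0 -omega0_evecr; apply/eqP/wx0.
  apply: coord_eq => i; rewrite linear0 //.
  by rewrite -(omega0_hvecr i x0); apply: wx0.
rewrite /= /omega0 ![Z _ _]in_wedge2_h_eq0 ?addr0; try by move=> i; apply: hcoord_lie.
rewrite -!big_split /=; apply: big1 => i _.
by rewrite /wedge !ecoord_lie !hcoord_lie /wedge; ring.
Qed.

Lemma omega0_exact :
  exact_form (omega0 e Z) <-> forall x y : g, Z x y = 0.
Proof.
have [_ _ hh_br] := hbr; split=> [[alpha w_alpha] x y | Z0].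
  (* On h the brackets vanish, and so do the wedge terms of [omega0]; only Z is left. *)
  have Zhh i j : Z (h_ i) (h_ j) = 0.
    have := w_alpha (h_ i) (h_ j).
    rewrite hh_br linear0 /= /omega0 big1 ?add0r // => k _.
    by rewrite /wedge !ecoord_hvec !mul0r subrr.
  have Zhv i z : Z (h_ i) z = 0.
    rewrite [z]coord_decomp linearDr !linear_sumr !big1 ?addr0 // => j _.
      by rewrite linearZr_LR /= Zhh mulr0.
    rewrite linearZr_LR /= skewC in_wedge2_h_eq0 ?oppr0 ?mulr0 // => k.
    exact: hcoord_evec.
  rewrite [x]coord_decomp linearDl !linear_sumlz !big1 ?addr0 // => j _.
    by rewrite linearZl_LR /= Zhv mulr0.
  rewrite linearZl_LR /= in_wedge2_h_eq0 ?mulr0 // => k.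
  exact: hcoord_evec.
(* The sign compensates the order of the factors in [ecoord_lie]. *)
pose alpha (x : g) := - \sum_i ecoord e i x.
have alpha_lin : scalar alpha.
  move=> k u v; rewrite /alpha mulrN -opprD mulr_sumr -big_split /=.
  by congr (- _); apply: eq_bigr => i _; rewrite linearP.
pose aL := GRing.isLinear.Build K g K _ alpha alpha_lin.
pose A : {scalar g} := HB.pack alpha aL.
exists A => x y; rewrite /= /alpha /omega0 Z0 addr0 -sumrN.
by apply: eq_bigr => i _; rewrite ecoord_lie /wedge; ring.
Qed.

End InWedge2H.

(** * Reduction of an arbitrary symplectic form *)

Section NormalForm.
Hypothesis two_neq0 : 2%:R != 0 :> K.
Variable omega : {skew_symmetric g}.
Hypothesis omega_sympl : symplectic omega.

(** In the cocycle identity on [x_ i], [x_ j], [h_ i] with distinct i and j, the only nonzero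
    bracket is that of [h_ i] and [x_ i]. The diagonal case needs 2 to be invertible. *)
Lemma symplectic_evec_evec i j : omega (x_ i) (x_ j) = 0.
Proof.
have [he_br ee_br _] := hbr.
have [->|ij] := eqVneq i j; first exact: skew_xx.
have := omega_sympl.2 (x_ i) (x_ j) (h_ i).
rewrite ee_br [ [| x_ j, h_ i |] ]lieC !he_br eqxx (negPf ij) oppr0.
by rewrite !linear0l !add0r.
Qed.

Lemma symplectic_evec_hvec i j : i != j -> omega (x_ i) (h_ j) = 0.
Proof.
have [he_br _ hh_br] := hbr => ij.
have := omega_sympl.2 (x_ i) (h_ i) (h_ j).
rewrite hh_br [ [| x_ i, h_ i |] ]lieC !he_br eqxx eq_sym (negPf ij).
rewrite !linear0l !addr0 linearNl => /eqP.
by rewrite oppr_eq0 => /eqP.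
Qed.

Lemma symplectic_coord (x y : g) :
  omega x y =
    \sum_i omega (x_ i) (h_ i) * wedge (ecoord e i) (hcoord e i) x y +
    wedge2_h e (\matrix_(i, j) omega (h_ i) (h_ j)) x y.
Proof.
have w_sum (u v : 'I_n -> K) (a b : 'I_n -> g) :
    omega (\sum_i u i *: a i) (\sum_j v j *: b j) =
    \sum_i \sum_j u i * v j * omega (a i) (b j).
  rewrite linear_sumlz; apply: eq_bigr => i _.
  rewrite linear_sumr; apply: eq_bigr => j _.
  by rewrite linearZl_LR linearZr_LR /= mulrA.
have w_eh (u v : 'I_n -> K) :
    omega (\sum_i u i *: x_ i) (\sum_j v j *: h_ j) =
    \sum_i omega (x_ i) (h_ i) * (u i * v i).
  rewrite w_sum; apply: eq_bigr => i _.
  rewrite (bigD1 i) //= big1 ?addr0 1?mulrC // => j ji.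
  by rewrite symplectic_evec_hvec ?mulr0 // eq_sym.
rewrite {1}[x]coord_decomp {1}[y]coord_decomp linearDl !linearDr /= w_eh.
rewrite [X in X + _ + _]w_sum [X in X + _ + _]big1 => [ |i _]; last first.
  by rewrite big1 // => j _; rewrite symplectic_evec_evec mulr0.
rewrite [X in _ + (X + _)]skewC w_eh add0r addrA -sumrN -big_split /=.
congr (_ + _); first by apply: eq_bigr => i _; rewrite /wedge; ring.
rewrite w_sum sum_skew_pairs => [ |i|i j]; last 2 first.
- exact: skew_xx.
- exact: skewC.
apply: eq_bigr => i _; apply: eq_bigr => j _.
by rewrite mxE /wedge; ring.
Qed.

(** In [symplectic_coord] the vector [x_ i] meets only the i-th wedge, so a zero coefficient there
    would put it in the radical. *)
Lemma symplectic_pairing_neq0 i : omega (x_ i) (h_ i) != 0.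
Proof.
apply/eqP => w0; have /nondegenerateP/(_ (x_ i)) xi0 := omega_sympl.1.
suff /xi0 x0 : forall y, omega (x_ i) y = 0.
  have := ecoord_evec i i; rewrite x0 linear0 eqxx => /eqP.
  by rewrite eq_sym oner_eq0.
move=> y; rewrite symplectic_coord big1 ?add0r => [ |j _].
  apply: (in_wedge2_h_eq0 (Z := wedge2_h e _)) => [ |k]; first by eexists.
  exact: hcoord_evec.
rewrite /wedge ecoord_evec hcoord_evec; have [->|_] := eqVneq j i; last first.
  by rewrite mul0r mulr0 subrr mulr0.
by rewrite w0 mul0r.
Qed.

(* The rescaling of each e_i that absorbs omega(e_i, e_(n+i)) is an           *)
(* automorphism, because brackets are linear in the e_i.                      *)
Lemma symplectic_normal_form :
  symplectomorphic omega
    (omega0 e (wedge2_h e (\matrix_(i, j) omega (h_ i) (h_ j)))).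
Proof.
pose scale (a : 'I_n -> K) (x : g) :=
  \sum_i (a i * ecoord e i x) *: x_ i + \sum_i hcoord e i x *: h_ i.
have scale_e a i x : ecoord e i (scale a x) = a i * ecoord e i x.
  exact: ecoord_sum.
have scale_h a i x : hcoord e i (scale a x) = hcoord e i x.
  exact: hcoord_sum.
pose a i := (omega (x_ i) (h_ i))^-1.
have T_lin : linear (scale a).
  move=> k u v; apply: coord_eq => i.
    by rewrite scale_e !linearP /= !scale_e; ring.
  by rewrite scale_h !linearP /= !scale_h.
pose TL := GRing.isLinear.Build K g g _ (scale a) T_lin.
pose T : {linear g -> g} := HB.pack (scale a) TL.
exists T => [ |x y] /=.
  split.
    (* The inverse automorphism rescales by the pairings themselves. *)
    exists (scale (fun i => omega (x_ i) (h_ i))) => x; apply: coord_eq => i;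
      rewrite !(scale_e, scale_h) // mulrA /a ?mulVf ?mulfV ?mul1r //;
      exact: symplectic_pairing_neq0.
  move=> x y /=; apply: coord_eq => i.
    by rewrite scale_e !ecoord_lie /wedge !scale_e !scale_h; ring.
  by rewrite scale_h !hcoord_lie.
rewrite symplectic_coord /omega0; congr (_ + _).
  apply: eq_bigr => i _; rewrite /wedge !scale_e !scale_h /a.
  by field; apply: symplectic_pairing_neq0.
(* The h-coordinates are fixed by the rescaling, so the part on h is unchanged. *)
by apply: eq_bigr => i _; apply: eq_bigr => j _; rewrite /wedge !scale_h.
Qed.

End NormalForm.
End Coordinates.

Theorem proposition2 (R : realType) (K : fieldType)
    (hK : K = R :> fieldType \/ K = R[i] :> fieldType)
    (n : nat) (hn : (1 <= n)%N)
    (g : lieAlgType K) (e : (n + n).-tuple g)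
    (he : basis_of fullv e) (hbr : structure_brackets e) :
  (forall omega : {skew_symmetric g}, symplectic omega ->
     exists2 Z : {skew_symmetric g}, in_wedge2_h e Z &
       symplectomorphic omega (omega0 e Z)) /\
  (forall Z : {skew_symmetric g}, in_wedge2_h e Z ->
     symplectic (omega0 e Z) /\
     (exact_form (omega0 e Z) <-> forall x y : g, Z x y = 0)).
Proof.
(* The choice of K enters here: characteristic 0 makes skew-symmetric forms alternating. *)
have two_neq0 : 2%:R != 0 :> K.
  by case: hK => ->; rewrite Num.Theory.pnatr_eq0.
split=> [omega omega_sympl | Z Zh].
  exists (wedge2_h e (\matrix_(i, j) omega (hvec e i) (hvec e j))).
    by eexists.
  exact: symplectic_normal_form.
split; first exact: omega0_symplectic.
exact: omega0_exact.
Qed.
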